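(* Let $(\mathcal{G},\ell)$ be a labelled graph, with $\mathcal{G}=(V,E)$ and $E=R\cup D$, and let $q$ be an admissible positive integer, i.e. $\ell(e)$ divides $q$ for all $e\in E$. Let $M_{\mathcal{G},\ell}(x,y)$ be the arithmetic Tutte polynomial associated to $(\mathcal{G},\ell)$, and let $k$ be the number of connected components of the graph $\mathcal{G}$. Then the number $\chi_{\mathcal{G},\ell}(q)$ of arithmetic (proper) $q$-colorings of $(\mathcal{G},\ell)$ is $$\chi_{\mathcal{G},\ell}(q)=(-1)^{|\overline{V}|-k}\,q^k\,M_{\mathcal{G},\ell}(1-q,0).$$
   Context: **Labelled graphs.** A graph $\mathcal{G}=(V,E)$ consists of a finite set $V$ of vertices and a finite multiset $E$ of edges, each edge being a 2-element multiset of vertices; parallel edges are allowed (and regarded as distinct edges), and graphs are assumed to have no loops. The edges are of two kinds: $E$ is a disjoint union $E=R\cup D$, where elements of $R$ are called regular edges and elements of $D$ dotted edges. A labelled graph is a pair $(\mathcal{G},\ell)$ with $\mathcal{G}$ such a graph and $\ell:E\to\{1,2,3,\dots\}$ a map. Connected components of $\mathcal{G}$ are taken with respect to all edges in $E=R\cup D$. The classical contraction of an edge is the removal of that edge and the identification of its two endpoints. $\overline{\mathcal{G}}=(\overline{V},\overline{E})$ denotes the graph (possibly with loops) obtained from $\mathcal{G}$ by classically contracting all edges in $D$; so $|\overline{V}|$ is the number of connected components of $(V,D)$. **Arithmetic colorings.** An arithmetic (proper) $q$-coloring of $(\mathcal{G},\ell)$ is a map $c:V\to\mathbb{Z}/q\mathbb{Z}$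 such that (1) $\ell(e)c(u)\neq\ell(e)c(v)$ for every $e=\{u,v\}\in R$; (2) $\ell(e)c(u)=\ell(e)c(v)$ for every $e=\{u,v\}\in D$. $\chi_{\mathcal{G},\ell}(q)$ denotes the number of these. **Arithmetic Tutte polynomial of a labelled graph.** Enumerate $V=\{v_1,\dots,v_n\}$ and fix an orientation of the edges. To an edge $e$ oriented as $(v_i,v_j)$ associate the vector $x_e\in\mathbb{Z}^n$ with $i$-th coordinate $\ell(e)$, $j$-th coordinate $-\ell(e)$ and all other coordinates $0$. Let $X_D=\{x_e: e\in D\}$, $G=\mathbb{Z}^n/\langle X_D\rangle$, and for $e\in R$ let $\overline{x_e}$ be the class of $x_e$ in $G$. For $A\subseteq R$ let $\langle A\rangle$ be the subgroup of $G$ generated by $\{\overline{x_e}:e\in A\}$; let $rk(A)$ be the maximal rank of a free abelian subgroup of $\langle A\rangle$; let $G_A$ be the maximal subgroup of $G$ containing $\langle A\rangle$ with finite index; and let $m(A)=|G_A:\langle A\rangle|$. Then $$M_{\mathcal{G},\ell}(x,y)=\sum_{A\subseteq R}m(A)(x-1)^{rk(R)-rk(A)}(y-1)^{|A|-rk(A)},$$ which does not depend on the chosen orientation. *)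

(* Defs.v *)
From HB Require Import structures.
From mathcomp Require Import all_boot all_order all_algebra finmap ring_quotient.
From mathcomp Require Import boolp classical_sets cardinality.

Set Implicit Arguments.
Unset Strict Implicit.
Unset Printing Implicit Defensive.

Import GRing.Theory Num.Theory.

Local Open Scope ring_scope.

(* Edges form a type of their own, so parallel edges are distinct; [card_ends]
   rules out loops. *)
Record labelled_graph := LabelledGraph {
  vertex : finType;
  edge : finType;
  ends : edge -> {set vertex};
  card_ends : forall e, #|ends e| = 2;
  dotted : {set edge};
  label : edge -> nat;
  label_gt0 : forall e, (0 < label e)%N
}.

Definition regular (G : labelled_graph) : {set edge G} := (~: dotted G)%SET.

Definition adj (G : labelled_graph) (S : {set edge G}) : rel (vertex G) :=
  fun u v => [exists e in S, ends e == [set u; v]%SET].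

Definition components (G : labelled_graph) : nat :=
  n_comp (adj [set: edge G]%SET) predT.

(* Contracting the dotted edges identifies their endpoints: a vertex of the
   contracted graph is a block of vertices joined by dotted paths. *)
Definition contracted_vertices (G : labelled_graph) : {set {set vertex G}} :=
  equivalence_partition (connect (adj (dotted G))) [set: vertex G]%SET.

Definition admissible (G : labelled_graph) (q : nat) : Prop :=
  forall e : edge G, (label e %| q)%N.

(* Elements of Z/qZ are represented by their residues in ['I_q], which, unlike
   ['Z_q], is also correct for q = 1. *)
Definition arithmetic_coloring (G : labelled_graph) (q : nat)
    (c : {ffun vertex G -> 'I_q}) : bool :=
  [forall e, forall u, forall v, (ends e == [set u; v]%SET) ==>
    (if e \in dotted G
     then label e * c u == label e * c v %[mod q]
     else label e * c u != label e * c v %[mod q])%N].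

Definition chi (G : labelled_graph) (q : nat) : nat :=
  #|[set c : {ffun vertex G -> 'I_q} | arithmetic_coloring c]%SET|.

Definition orientation (G : labelled_graph)
    (o : edge G -> vertex G * vertex G) : Prop :=
  forall e, ends e = [set (o e).1; (o e).2]%SET.

Definition subgroup (Z : zmodType) (H : set Z) : Prop :=
  H 0 /\ forall x y, H x -> H y -> H (x - y).

Definition generated (Z : zmodType) (S : set Z) : set Z :=
  smallest (@subgroup Z) S.

Lemma generated_subgroup (Z : zmodType) (S : set Z) : subgroup (generated S).
Proof.
split=> [H [[H0 _] _] //|x y Hx Hy H HS].
by case: (HS) => -[_ HB] _; apply: HB; [apply: Hx|apply: Hy].
Qed.

Definition generated_pred (Z : zmodType) (S : set Z) : {pred Z} :=
  fun x => `[< generated S x >].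

Lemma generated_zmod_closed (Z : zmodType) (S : set Z) :
  zmod_closed (generated_pred S).
Proof.
have [S0 SB] := generated_subgroup S.
by split=> [|x y /asboolP Sx /asboolP Sy]; apply/asboolP; [|apply: SB].
Qed.

HB.instance Definition _ (Z : zmodType) (S : set Z) :=
  GRing.isZmodClosed.Build Z (generated_pred S) (generated_zmod_closed S).

(* Z^V, with V itself as index set, so that no enumeration of V is chosen. *)
Definition lattice (G : labelled_graph) : zmodType := {ffun vertex G -> int}.

Definition edge_vector (G : labelled_graph)
    (o : edge G -> vertex G * vertex G) (e : edge G) : lattice G :=
  [ffun v => (label e)%:Z *+ (v == (o e).1) - (label e)%:Z *+ (v == (o e).2)].

Definition dotted_vectors (G : labelled_graph)
    (o : edge G -> vertex G * vertex G) : set (lattice G) :=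
  [set edge_vector o e | e in [set` dotted G]]%classic.

Definition edge_group (G : labelled_graph)
    (o : edge G -> vertex G * vertex G) : zmodType :=
  Quotient.quot (generated_pred (dotted_vectors o)).

Definition edge_class (G : labelled_graph)
    (o : edge G -> vertex G * vertex G) (e : edge G) : edge_group o :=
  (\pi_(edge_group o) (edge_vector o e))%qT.

Definition span_edges (G : labelled_graph)
    (o : edge G -> vertex G * vertex G) (A : {set edge G}) :
    set (edge_group o) :=
  generated [set edge_class o e | e in [set` A]]%classic.

Arguments span_edges {G} o A _.

Definition free_abelian_of_rank (Z : zmodType) (F : set Z) (r : nat) : Prop :=
  exists b : 'I_r -> Z, F = generated (range b) /\
    forall a : 'I_r -> int, \sum_i b i *~ a i = 0 -> forall i, a i = 0.

Definition has_free_subgroup (Z : zmodType) (H : set Z) : set nat :=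
  fun r => exists F : set Z, (F `<=` H)%classic /\ free_abelian_of_rank F r.

(* The default value 0 is irrelevant for subgroups of finitely generated
   groups, where the maximum exists. *)
Definition free_rank (Z : zmodType) (H : set Z) : nat :=
  xget 0%N [set r | has_free_subgroup H r /\
    forall s, has_free_subgroup H s -> (s <= r)%N]%classic.

Definition cosets (Z : zmodType) (H K : set Z) : set (set Z) :=
  [set [set x + y | y in K] | x in H]%classic.

Definition subgroup_index (Z : zmodType) (H K : set Z) : nat :=
  #|` fset_set (cosets H K)|.

Definition finite_index_over (Z : zmodType) (K : set Z) : set (set Z) :=
  fun H => [/\ subgroup H, (K `<=` H)%classic & finite_set (cosets H K)].

(* The default value K is irrelevant when the ambient group Z is finitely
   generated, where the maximum exists. *)
Definition max_finite_index_over (Z : zmodType) (K : set Z) : set Z :=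
  xget K [set H | finite_index_over K H /\
    forall H', finite_index_over K H' -> (H' `<=` H)%classic]%classic.

Definition rk (G : labelled_graph)
    (o : edge G -> vertex G * vertex G) (A : {set edge G}) : nat :=
  free_rank (span_edges o A).

Definition multiplicity (G : labelled_graph)
    (o : edge G -> vertex G * vertex G) (A : {set edge G}) : nat :=
  subgroup_index (max_finite_index_over (span_edges o A)) (span_edges o A).

(* A polynomial in x = 'X and y = 'Y. *)
Definition arithmetic_tutte (G : labelled_graph)
    (o : edge G -> vertex G * vertex G) : {poly {poly int}} :=
  \sum_(A : {set edge G} | A \subset regular G)
    (multiplicity o A)%:R * ('X - 1) ^+ (rk o (regular G) - rk o A)
      * ('Y - 1) ^+ (#|A| - rk o A).

(* Main.v *)
From HB Require Import structures.
Require Import Defs.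
From mathcomp Require Import all_boot all_order all_algebra all_field ring.
From mathcomp Require Import finmap ring_quotient.
From mathcomp Require Import boolp classical_sets cardinality.

Set Implicit Arguments.
Unset Strict Implicit.
Unset Printing Implicit Defensive.

Import GRing.Theory Num.Theory.

Local Open Scope ring_scope.

(** Write L(S) for the subgroup of Z^V spanned by the edge vectors of a set S
    of edges, Sat(S) for the vectors whose sum over each connected component of
    S vanishes, k(S) for the number of these components, and D for the set of
    dotted edges.  A vector of Sat(S) is an integer combination of differences
    e_v - e_r, where r represents the component of v; since every label divides
    q, each q (e_v - e_r) lies in L(S) (telescope along a path).  Hence
    q Sat(S) <= L(S) <= Sat(S), and Sat(S) is the saturation of L(S).

    All the data of the Tutte polynomial follow.  Modulo L(D), the group
    spanned by a set A of regular edges is L(S)/L(D) with S the union of A and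
    D, and the largest subgroup containing it with finite index is Sat(S)/L(D).
    So m(A) = [Sat(S) : L(S)] ([multiplicityE]) and rk(A) = k(D) - k(S)
    ([rk_component_count]).

    On the side of colorings, inclusion-exclusion over the inequalities imposed
    by the regular edges ([chi_inclusion_exclusion]) reduces chi(q) to the
    number N(S) of maps V -> Z/qZ that satisfy the equalities imposed by all
    edges of S; these maps form the annihilator of L(S) for the standard pairing
    modulo q.  Duality in (Z/qZ)^V ([card_annihilator]) says that a subgroup and
    its annihilator have orders with product q^|V|.  Applied to L(S) and to
    Sat(S), whose annihilator consists of the q^k(S) maps constant on
    components, it gives N(S) = [Sat(S) : L(S)] q^k(S)
    ([card_equality_colorings]): reduction modulo q preserves the index because
    the vectors of Sat(S) in its kernel are q times vectors of Sat(S), hence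
    lie in L(S).  The theorem is then an identity between two sums over A,
    which holds term by term. *)

(** * Subgroups and their indices *)

Section Subgroups.
Variable Z : zmodType.
Implicit Types (H K S : set Z) (x y : Z).

Lemma subgroupN H x : subgroup H -> H x -> H (- x).
Proof. by case=> H0 HB Hx; rewrite -sub0r; apply: HB. Qed.

Lemma subgroupD H x y : subgroup H -> H x -> H y -> H (x + y).
Proof.
move=> sH Hx Hy; have [_ HB] := sH.
by rewrite -[y]opprK; apply: HB => //; apply: subgroupN.
Qed.

Lemma subgroup_sum H (I : Type) (r : seq I) (P : pred I) (F : I -> Z) :
  subgroup H -> (forall i, P i -> H (F i)) -> H (\sum_(i <- r | P i) F i).
Proof.
move=> sH HF; elim/big_rec: _ => [|i x Pi Hx]; first by case: sH.
by apply: subgroupD => //; apply: HF.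
Qed.

Lemma subgroupMn H x n : subgroup H -> H x -> H (x *+ n).
Proof.
move=> sH Hx; elim: n => [|n IHn]; first by rewrite mulr0n; case: sH.
by rewrite mulrS; apply: subgroupD.
Qed.

Lemma subgroupMz H x (n : int) : subgroup H -> H x -> H (x *~ n).
Proof.
move=> sH Hx; case: n => n; first exact: subgroupMn.
by rewrite NegzE mulrNz; apply: subgroupN => //; apply: subgroupMn.
Qed.

Lemma generated_min S H :
  subgroup H -> (S `<=` H)%classic -> (generated S `<=` H)%classic.
Proof. by move=> sH SH x Sx; apply: Sx. Qed.

Lemma sub_generated S : (S `<=` generated S)%classic.
Proof. by move=> x Sx H [_ SH]; apply: SH. Qed.

Lemma subgroup_preimage (Z' : zmodType) (f : {additive Z -> Z'}) (H : set Z') :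
  subgroup H -> subgroup (f @^-1` H)%classic.
Proof.
move=> [H0 HB]; split=> [|x y Hx Hy]; rewrite /preimage/= ?raddf0 ?raddfB //.
exact: HB.
Qed.

Lemma subgroup_image (Z' : zmodType) (f : {additive Z -> Z'}) H :
  subgroup H -> subgroup (f @` H)%classic.
Proof.
move=> [H0 HB]; split=> [|_ _ [x Hx <-] [y Hy <-]].
  by exists 0; rewrite ?raddf0.
by exists (x - y); [apply: HB | rewrite raddfB].
Qed.

(** Integer combinations of the family already form a subgroup. *)
Lemma generated_comb (I : finType) (A : {pred I}) (g : I -> Z) x :
  generated [set g i | i in [set` A]]%classic x ->
  exists a : I -> int, x = \sum_(i in A) g i *~ a i.
Proof.
apply: (@generated_min _
  [set x | exists a : I -> int, x = \sum_(i in A) g i *~ a i]%classic).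
  split=> [|_ _ [a ->] [b ->]].
    by exists (fun=> 0); rewrite big1 // => i _; rewrite mulr0z.
  exists (fun i => a i - b i); rewrite -sumrB; apply: eq_bigr => i _.
  by rewrite mulrzBr.
move=> _ [j /= Aj <-]; exists (fun i => (i == j)%:Z).
rewrite (bigD1 j) //= eqxx mulr1z big1 ?addr0 // => i /andP[_ /negbTE->].
by rewrite mulr0z.
Qed.

Lemma coset_eq K x y :
  subgroup K -> (([set x + k | k in K] = [set y + k | k in K])%classic <->
                 K (x - y)).
Proof.
move=> sK; split=> [eq_xy | Kxy]; last first.
  rewrite eqEsubset; split=> _ [k Kk <-].
    exists (x - y + k); first exact: subgroupD.
    by rewrite addrA addrCA subrr addr0.
  exists (y - x + k); last by rewrite addrA addrCA subrr addr0.
  by apply: subgroupD => //; rewrite -opprB; apply: subgroupN.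
have: [set x + k | k in K]%classic x by exists 0; [case: sK | rewrite addr0].
by rewrite eq_xy => -[k Kk <-]; rewrite addrAC subrr add0r.
Qed.

End Subgroups.

(** X |-> f @` X is a bijection between the two sets of cosets: if x + K and
    y + K have the same image, some x - (y + k) lies in H and in the kernel of
    f, hence in K. *)
Lemma cosets_image (Z Z' : zmodType) (f : {additive Z -> Z'}) (H K : set Z) :
  subgroup H -> subgroup K -> (K `<=` H)%classic ->
  (forall x, H x -> f x = 0 -> K x) ->
  (cosets (f @` H) (f @` K) #= cosets H K)%card.
Proof.
move=> sH sK KH kerf.
rewrite (_ : cosets _ _ = (fun X => f @` X) @` cosets H K)%classic; last first.
  have imcoset x : ([set f x + y | y in f @` K] =
                    f @` [set x + y | y in K])%classic.
    rewrite eqEsubset; split=> [_ [_ [k Kk <-] <-] | _ [_ [k Kk <-] <-]].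
      by exists (x + k); [exists k | rewrite raddfD].
    by exists (f k); [exists k | rewrite raddfD].
  rewrite eqEsubset; split=> [_ [_ [x Hx <-] <-] | _ [_ [x Hx <-] <-]].
    by exists [set x + y | y in K]%classic; [exists x | rewrite imcoset].
  by exists (f x); [exists x | rewrite imcoset].
rewrite inj_card_eq // => _ _ /set_mem[x Hx <-] /set_mem[y Hy <-] eq_xy.
apply/(coset_eq _ _ sK).
have: (f @` [set x + k | k in K])%classic (f x).
  by exists x => //; exists 0; [case: sK | rewrite addr0].
rewrite eq_xy => -[_ [k Kk <-] eq_f].
rewrite (_ : x - y = x - (y + k) + k); last by rewrite opprD addrA subrK.
apply: subgroupD => //; apply: kerf; last by rewrite raddfB eq_f subrr.
have [_ HB] := sH; apply: HB => //; apply: subgroupD => //; exact: KH.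
Qed.

Lemma card_eq_subgroup_index (Z Z' : zmodType) (H K : set Z) (H' K' : set Z') :
  finite_set (cosets H K) -> (cosets H' K' #= cosets H K)%card ->
  subgroup_index H' K' = subgroup_index H K.
Proof.
move=> fin eqc; apply/fcard_eq => //.
by rewrite (eq_finite_set eqc).
Qed.

(** Lagrange's theorem: the fibers of x |-> x + K on H are translates of K. *)
Lemma card_subgroup_index (Z : zmodType) (H K : set Z) :
  finite_set H -> subgroup H -> subgroup K -> (K `<=` H)%classic ->
  #|` fset_set H| = (subgroup_index H K * #|` fset_set K|)%N.
Proof.
move=> finH sH sK KH; have finK := sub_finite_set KH finH.
pose h x : set Z := [set x + k | k in K]%classic.
rewrite card_fset_sum1 (partition_big_imfset _ h) /=.
rewrite /subgroup_index /cosets (fset_set_image h finH).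
transitivity (\sum_(X <- (h @` fset_set H)%fset) #|` fset_set K|)%N; last first.
  by rewrite big_const_seq count_predT iter_addn_0 mulnC.
rewrite [LHS]big_seq [RHS]big_seq; apply: eq_bigr => _ /imfsetP[x /= Hx ->].
have {}Hx : H x by move: Hx; rewrite in_fset_set // => /set_mem.
rewrite big_fset_condE -card_fset_sum1.
have -> : [fset y in fset_set H | h y == h x]%fset =
          [fset (x + k)%R | k in fset_set K]%fset.
  apply/fsetP => y; rewrite !inE /= in_fset_set //; apply/andP/imfsetP.
    move=> [/set_mem Hy /eqP/(coset_eq _ _ sK) Kyx] /=.
    by exists (y - x); rewrite ?in_fset_set ?mem_set // addrC subrK.
  move=> [k /=]; rewrite in_fset_set // => /set_mem Kk ->; split.
    apply/mem_set; apply: (subgroupD sH Hx); exact: KH.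
  by apply/eqP/(coset_eq _ _ sK); rewrite addrAC subrr add0r.
by rewrite card_imfset //; apply: addrI.
Qed.

(** Pigeonhole: two distinct multiples of x lie in the same coset of K. *)
Lemma finite_index_multiple (Z : zmodType) (H K : set Z) (x : Z) :
  subgroup K -> finite_index_over K H -> H x ->
  exists2 m, (0 < m)%N & K (x *+ m).
Proof.
move=> sK [sH _ finHK] Hx.
pose f (m : nat) : set Z := [set x *+ m + k | k in K]%classic.
have [i [j [lt_ij eq_ij]]] : exists i j, (i < j)%N /\ f i = f j.
  pose C := fset_set (cosets H K).
  have /(uniqPn set0)[i [j [lt_ij]]] :
      ~~ uniq [seq f m | m <- iota 0 #|` C|.+1].
    apply/negP => /uniq_leq_size/(_ (_ : {subset _ <= C})) leC.
    have: (#|` C|.+1 <= #|` C|)%N.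
      rewrite -[X in (X <= _)%N](size_iota 0) -(size_map f); apply: leC.
      move=> _ /mapP[m _ ->]; rewrite in_fset_set //; apply/mem_set.
      by exists (x *+ m) => //; apply: subgroupMn.
    by rewrite ltnn.
  rewrite size_map size_iota => lt_j.
  rewrite !(nth_map 0%N) ?size_iota ?(ltn_trans lt_ij) //.
  by rewrite !nth_iota ?(ltn_trans lt_ij) // => eq_ij; exists i, j.
exists (j - i)%N; first by rewrite subn_gt0.
by rewrite mulrnBr ?(ltnW lt_ij) //; apply/(coset_eq _ _ sK).
Qed.

(** * Free rank *)

(** A rational relation becomes integral after multiplication by its
    denominators. *)
Lemma int_relation (s t : nat) (A : 'I_s -> 'I_t -> int) :
  (t < s)%N ->
  exists2 a : 'I_s -> int, exists i, a i != 0 &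
    forall j, \sum_i a i * A i j = 0.
Proof.
move=> lt_ts; pose B : 'M[rat]_(s, t) := \matrix_(i, j) (A i j)%:~R.
have /rowV0Pn[u /sub_kermxP uB0 u0] : kermx B != 0.
  rewrite kermx_eq0; apply/negP => /eqP eqB.
  by have := rank_leq_col B; rewrite eqB leqNgt lt_ts.
(* numq (u 0 i) * d i is u 0 i times the product of all denominators. *)
pose d i : int := \prod_(k | k != i) denq (u 0 k).
have ud i : (numq (u 0 i) * d i)%:~R = u 0 i * (\prod_k denq (u 0 k))%:~R.
  by rewrite (bigD1 i) //= !rmorphM /= numqE mulrA.
exists (fun i => numq (u 0 i) * d i).
  have /existsP[i ui] : [exists i, u 0 i != 0].
    apply: contraNT u0; rewrite negb_exists => /forallP u0.
    by apply/eqP/rowP => i; rewrite mxE; apply/eqP/negbNE/u0.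
  exists i; rewrite mulf_neq0 ?numq_eq0 //.
  by apply/prodf_neq0 => k _; apply: denq_neq0.
move=> j; apply: (@intr_inj rat); rewrite rmorph_sum /= rmorph0.
transitivity ((u *m B) 0 j * (\prod_k denq (u 0 k))%:~R).
  rewrite mxE mulr_suml; apply: eq_bigr => i _.
  by rewrite rmorphM /= ud mxE mulrAC.
by rewrite uB0 mxE mul0r.
Qed.

(** The multiples x *+ n of s > #|J| independent elements would satisfy a
    relation with coefficients c, so that the elements themselves would satisfy
    the relation with coefficients n c.  Allowing the factor n avoids the choice
    of a basis of H. *)
Lemma free_subgroup_rank_le (Z : zmodType) (H : set Z) (I : finType)
    (J : {pred I}) (g : I -> Z) (n s : nat) :
  (0 < n)%N ->
  (forall x, H x -> exists a : I -> int, x *+ n = \sum_(i in J) g i *~ a i) ->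
  has_free_subgroup H s -> (s <= #|J|)%N.
Proof.
move=> n0 Hg [F [FH [b [Fb free_b]]]].
have Hb i : H (b i) by apply: FH; rewrite Fb; apply: sub_generated; exists i.
have [a ga] := choice (fun i => Hg _ (Hb i)).
rewrite leqNgt; apply/negP => lt_s.
have [c [i ci0] rel_c] :=
  int_relation (fun i j => a i (enum_val j)) lt_s.
have /free_b/(_ i)/eqP : \sum_i b i *~ (c i *+ n) = 0.
  transitivity (\sum_i \sum_(j in J) (g j *~ (a i j)) *~ c i).
    apply: eq_bigr => k _; rewrite -mulrz_suml -ga.
    by rewrite -mulr_natl natz mulrzA.
  rewrite exchange_big /= big_enum_val big1 // => j _.
  transitivity (g (enum_val j) *~ \sum_i c i * a i (enum_val j)).
    by rewrite mulrz_sumr; apply: eq_bigr => k _; rewrite -mulrzA mulrC.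
  by rewrite rel_c mulr0z.
by rewrite mulrn_eq0 (gtn_eqF n0) (negbTE ci0).
Qed.

Lemma free_rank_unique (Z : zmodType) (H : set Z) (r : nat) :
  has_free_subgroup H r -> (forall s, has_free_subgroup H s -> (s <= r)%N) ->
  free_rank H = r.
Proof.
move=> Hr maxr; apply: xget_unique => // s [Hs maxs].
by apply/eqP; rewrite eqn_leq maxr // maxs.
Qed.

Lemma free_rank_le (Z : zmodType) (H : set Z) (r : nat) :
  (forall s, has_free_subgroup H s -> (s <= r)%N) -> (free_rank H <= r)%N.
Proof.
move=> max_r; rewrite /free_rank.
by case: xgetP => // s _ [Hs _]; apply: max_r.
Qed.

Lemma free_rank_eq (Z : zmodType) (H : set Z) (I : finType)
    (J : {pred I}) (g : I -> Z) (n : nat) :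
  (0 < n)%N -> subgroup H -> (forall i, i \in J -> H (g i)) ->
  (forall a : I -> int, \sum_(i in J) g i *~ a i = 0 ->
     forall i, i \in J -> a i = 0) ->
  (forall x, H x -> exists a : I -> int, x *+ n = \sum_(i in J) g i *~ a i) ->
  free_rank H = #|J|.
Proof.
move=> n0 sH Hg free_g span_g; apply: free_rank_unique; last first.
  by move=> s; apply: free_subgroup_rank_le n0 span_g.
pose b (i : 'I_#|J|) := g (enum_val i).
exists (generated (range b)); split.
  by apply: generated_min => // _ [i _ <-]; apply/Hg/enum_valP.
exists b; split=> // a rel_a i.
pose a' k := a (enum_rank_in (enum_valP i) k).
have a'E j : a' (enum_val j) = a j by rewrite /a' enum_valK_in.
rewrite -a'E; apply: (free_g a' _ _ (enum_valP i)).
by rewrite big_enum_val -[RHS]rel_a; apply: eq_bigr => j _; rewrite a'E.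
Qed.

(** * Duality modulo q *)

Section Duality.
Variables (V : finType) (n : nat).
Local Notation q := n.+1.
Local Notation residues := {ffun V -> 'I_q}.
Local Notation vectors := {ffun V -> int}.
Implicit Types (c h : residues) (y : vectors).

Definition reduce y : residues := [ffun v => inZp `|(y v %% q)%Z|%N].

Lemma reduceE y v : (reduce y v)%:Z = (y v %% q)%Z.
Proof.
by rewrite ffunE /= -modz_nat gez0_abs ?modz_ge0 // modz_mod.
Qed.

Lemma reduceD : {morph reduce : y z / y + z}.
Proof.
move=> y z; apply/ffunP => v; rewrite [RHS]ffunE; apply/val_inj/eqP.
by rewrite -eqz_nat /= -modz_nat PoszD !reduceE modzDm ffunE.
Qed.

Lemma reduce_is_zmod_morphism : zmod_morphism reduce.
Proof.
move=> y z; apply: (addIr (reduce z)); rewrite subrK -reduceD.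
by rewrite subrK.
Qed.

HB.instance Definition _ :=
  GRing.isZmodMorphism.Build vectors residues reduce reduce_is_zmod_morphism.

Lemma reduce_eq0 y : reduce y = 0 -> forall v, (q %| y v)%Z.
Proof.
by move=> y0 v; apply/dvdz_mod0P; rewrite -reduceE y0 ffunE.
Qed.

Definition pairing c y : int := \sum_v (c v)%:Z * y v.

Lemma pairingB c : {morph pairing c : y z / y - z}.
Proof.
move=> y z; rewrite /pairing -sumrB; apply: eq_bigr => v _.
by rewrite !ffunE mulrBr.
Qed.

Definition annihilates c (L : set vectors) : Prop :=
  forall y, L y -> (q %| pairing c y)%Z.

Lemma annihilates_generated c (S : set vectors) :
  (forall y, S y -> (q %| pairing c y)%Z) -> annihilates c (generated S).
Proof.
move=> annS; apply: generated_min => //; split=> [|y z /= qy qz].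
  by rewrite /pairing big1 // => v _; rewrite ffunE mulr0.
by rewrite pairingB rpredB.
Qed.

(** For w a primitive q-th root of unity, the character of (Z/qZ)^V attached to
    c; the exponent matters modulo q only. *)
Definition chr (w : algC) c h : algC := w ^+ (\sum_v c v * h v).

Section PrimitiveRoot.
Variables (w : algC) (w_prim : q.-primitive_root w).

Lemma chrD c : {morph chr w c : h k / h + k >-> h * k}.
Proof.
move=> h k; rewrite /chr -exprD -big_split /= !expr_sum; apply: eq_bigr => v _.
by rewrite -mulnDr !exprM ffunE /= [_ ^+ (_ %% _)]expr_mod // -exprM mulnC exprM
   (prim_expr_order w_prim) expr1n.
Qed.

Lemma chr_reduce_eq1 c y : (chr w c (reduce y) == 1) = (q %| pairing c y)%Z.
Proof.
rewrite /chr -(prim_order_dvd w_prim) -[LHS]/(q%:Z %| Posz _)%Z /pairing.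
rewrite (big_morph Posz PoszD (erefl _)) /=.
set s := \sum_v _; set t := \sum_v _; rewrite -[s](subrK t) rpredDl //.
rewrite -sumrB rpred_sum // => v _; rewrite PoszM -mulrBr dvdz_mull //.
by rewrite -eqz_mod_dvd reduceE modz_mod.
Qed.

(** The sum is a product over V of geometric sums, and a factor with
    w ^+ h v != 1 vanishes. *)
Lemma sum_chr h : \sum_c chr w c h = if h == 0 then (q ^ #|V|)%:R else 0.
Proof.
under eq_bigr do rewrite /chr expr_sum.
rewrite -(bigA_distr_bigA (fun v (a : 'I_q) => w ^+ (a * h v))).
case: eqP => [->|/eqP h0].
  rewrite natrX -prodr_const; apply: eq_bigr => v _.
  rewrite (eq_bigr (fun=> 1)) => [|a _]; last by rewrite ffunE muln0.
  by rewrite sumr_const card_ord.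
have /existsP[v hv] : [exists v, h v != 0].
  apply: contraNT h0; rewrite negb_exists => /forallP h0.
  by apply/eqP/ffunP => v; rewrite ffunE; apply/eqP/negbNE/h0.
rewrite (bigD1 v) //=; set s := \sum_(_ < _) _.
suff -> : s = 0 by rewrite mul0r.
have wv : w ^+ h v != 1.
  rewrite -(prim_order_dvd w_prim) gtnNdvd ?ltn_ord // lt0n.
  by apply: contraNneq hv => hv0; apply/eqP/val_inj.
apply: (mulfI (x := w ^+ h v - 1)); first by rewrite subr_eq0.
rewrite mulr0 -[LHS](_ : (w ^+ h v) ^+ q - 1 = _).
  by rewrite exprAC (prim_expr_order w_prim) expr1n subrr.
by rewrite subrX1; congr (_ * _); apply: eq_bigr => a _; rewrite -exprM mulnC.
Qed.

(** If some y0 in L has a nontrivial value, translation by the image of y0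
    multiplies the sum by this value without changing it. *)
Lemma sum_chr_subgroup c (L : set vectors) : subgroup L ->
  \sum_(h <- fset_set (reduce @` L)) chr w c h =
  if `[< annihilates c L >] then (#|` fset_set (reduce @` L)|)%:R else 0.
Proof.
move=> sL; set H := (reduce @` L)%classic.
have finH : finite_set H by apply: finite_finset.
have sH : subgroup H by apply: subgroup_image.
case: asboolP => [cL | not_cL].
  rewrite card_fset_sum1 natr_sum big_seq [RHS]big_seq; apply: eq_bigr => h.
  rewrite in_fset_set // => /set_mem[y /cL qy <-].
  by apply/eqP; rewrite chr_reduce_eq1.
have [y0 Ly0 cy0] : exists2 y0, L y0 & chr w c (reduce y0) != 1.
  apply: contrapT => no_y; apply: not_cL => y Ly; rewrite -chr_reduce_eq1.
  by apply/negPn/negP => cy; apply: no_y; exists y.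
set s := LHS; apply: (mulfI (x := chr w c (reduce y0) - 1)).
  by rewrite subr_eq0.
rewrite mulr0 mulrBl mul1r; apply/eqP; rewrite subr_eq0; apply/eqP.
rewrite /s mulr_sumr.
transitivity
    (\sum_(h <- [seq reduce y0 + h | h <- fset_set H]) chr w c h).
  by rewrite big_map; apply: eq_bigr => h _; rewrite chrD.
apply: perm_big; apply: uniq_perm; rewrite ?map_inj_uniq ?fset_uniq //;
  first exact: addrI.
move=> h; rewrite in_fset_set //; apply/mapP/idP => [[k + ->]|/set_mem Hh].
  rewrite in_fset_set // => /set_mem Hk; apply/mem_set; apply: subgroupD => //.
  by exists y0.
exists (h - reduce y0); last by rewrite addrC subrK.
rewrite in_fset_set //; apply/mem_set; have [_ HB] := sH; apply: HB => //.
by exists y0.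
Qed.

End PrimitiveRoot.

(** Sum the values chr w c h over all c and all h in L mod q.  By
    orthogonality, each c contributes #|L mod q| or 0 according to whether it
    annihilates L, and only h = 0 contributes, with q^|V|. *)
Lemma card_annihilator (L : set vectors) : subgroup L ->
  (#|` fset_set (reduce @` L)| * #|[set c | `[< annihilates c L >]]%SET| =
   q ^ #|V|)%N.
Proof.
move=> sL; set H := (reduce @` L)%classic.
have [w w_prim] := C_prim_root_exists (ltn0Sn n).
have finH : finite_set H by apply: finite_finset.
apply/eqP; rewrite -(eqr_nat algC); apply/eqP.
transitivity (\sum_c \sum_(h <- fset_set H) chr w c h).
  under eq_bigr do rewrite (sum_chr_subgroup w_prim) //.
  by rewrite -big_mkcond /= sumr_const cardsE natrM mulr_natr.
rewrite exchange_big /=; under eq_bigr do rewrite (sum_chr w_prim).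
have [H0 _] : subgroup H by apply: subgroup_image.
rewrite (big_fsetD1 0) /=; last by rewrite in_fset_set //; apply/mem_set.
rewrite eqxx big_seq big1 ?addr0 // => h; rewrite !inE => /andP[/negbTE-> _] //.
Qed.

End Duality.

(** * Edge vectors and their saturation *)

Lemma set2_eq (T : finType) (a b c d : T) :
  [set a; b]%SET = [set c; d]%SET ->
  (a = c /\ b = d) \/ (a = d /\ b = c).
Proof.
move=> /setP eq_ab; move: (eq_ab a) (eq_ab b) (eq_ab c) (eq_ab d).
rewrite !inE !eqxx !orbT /= => /esym/orP[]/eqP-> /esym/orP[]/eqP->;
  rewrite ?eqxx ?orbb //=; do ?[by left | by right].
  by move=> _ /eqP->; left.
by move=> /eqP->; left.
Qed.

Section Graph.
Variables (G : labelled_graph) (o : edge G -> vertex G * vertex G).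
Hypothesis o_ends : orientation o.
Implicit Types (S T A : {set edge G}) (u v r : vertex G) (y : lattice G).

Definition rep S v : vertex G := fingraph.root (adj S) v.

Lemma adj_connect_sym S : connect_sym (adj S).
Proof.
apply: sym_connect_sym => u v; apply/eq_existsb => e.
by rewrite finset.setUC.
Qed.

Lemma rep_connect S u v : (rep S u == rep S v) = connect (adj S) u v.
Proof. exact: root_connect (adj_connect_sym S) u v. Qed.

Lemma rep_id S v : rep S (rep S v) = rep S v.
Proof. exact: root_root (adj_connect_sym S) v. Qed.

Lemma adj_orientation S e : e \in S -> adj S (o e).1 (o e).2.
Proof. by move=> Se; apply/exists_inP; exists e; rewrite // o_ends. Qed.

Lemma rep_orientation S e : e \in S -> rep S (o e).1 = rep S (o e).2.
Proof.
by move=> Se; apply/eqP; rewrite rep_connect; apply/connect1/adj_orientation.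
Qed.

Lemma rep_sub S T u v : S \subset T -> rep S u = rep S v -> rep T u = rep T v.
Proof.
move=> /fintype.subsetP ST /eqP; rewrite rep_connect => uv; apply/eqP.
rewrite rep_connect; apply: connect_sub uv => {u v} u v /exists_inP[e Se uv].
by apply/connect1/exists_inP; exists e; rewrite ?ST.
Qed.

Lemma rep_rep_sub S T v : S \subset T -> rep T (rep S v) = rep T v.
Proof. by move=> ST; apply: (rep_sub ST); rewrite rep_id. Qed.

Definition component_count S : nat := #|[set r | rep S r == r]%SET|.

Lemma component_countE S : n_comp (adj S) predT = component_count S.
Proof.
by rewrite /n_comp_mem; apply: eq_card => v; rewrite !inE andbT.
Qed.

Lemma card_blocks S :
  #|equivalence_partition (connect (adj S)) [set: vertex G]%SET| =
  component_count S.
Proof.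
pose block v : {set vertex G} :=
  [set u in [set: vertex G] | connect (adj S) v u]%SET.
rewrite /component_count -(card_in_imset (f := block)) => [|u v].
  apply: eq_card => X; apply/imsetP/imsetP => [[v _ ->]|[v _ ->]]; last first.
    by exists v; rewrite ?inE.
  exists (rep S v); rewrite ?inE ?rep_id //; apply/setP => u.
  by rewrite !inE -!rep_connect rep_id.
rewrite !inE => /eqP ru /eqP rv /setP/(_ v).
by rewrite !inE connect0 -rep_connect ru rv => /eqP.
Qed.

Definition component_sum S r y : int := \sum_(v | rep S v == r) y v.

Lemma component_sumB S r : {morph component_sum S r : y z / y - z}.
Proof.
by move=> y z; rewrite -sumrB; apply: eq_bigr => v _; rewrite !ffunE.
Qed.

HB.instance Definition _ S r :=
  GRing.isZmodMorphism.Build (lattice G) int (component_sum S r)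
    (component_sumB S r).

Definition unit_vector v : lattice G := [ffun u => (u == v)%:Z].

Lemma lattice_decomposition y : y = \sum_v unit_vector v *~ y v.
Proof.
apply/ffunP => u; rewrite sum_ffunE (bigD1 u) //= big1 ?addr0 => [|v vu].
  by rewrite ffunMzE ffunE eqxx intz.
by rewrite ffunMzE ffunE eq_sym (negbTE vu) mul0rz.
Qed.

Lemma edge_vectorE e :
  edge_vector o e =
  (unit_vector (o e).1 - unit_vector (o e).2) *+ label e.
Proof.
have scale (b : bool) : (label e)%:Z *+ b = b%:Z *+ label e.
  by case: b; rewrite ?mulr1n ?mulr0n ?natz ?mul0rn.
by apply/ffunP => v; rewrite ffunMnE 5!ffunE !scale [RHS]mulrnBl.
Qed.

Lemma component_sum_unit S r v :
  component_sum S r (unit_vector v) = (rep S v == r)%:Z.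
Proof.
rewrite /component_sum big_mkcond (bigD1 v) //= big1 => [|u uv].
  by rewrite ffunE eqxx; case: eqP.
by rewrite ffunE (negbTE uv) if_same.
Qed.

Definition edge_span S : set (lattice G) :=
  generated [set edge_vector o e | e in [set` S]]%classic.

Definition saturation S : set (lattice G) :=
  [set y | forall r, component_sum S r y = 0]%classic.

Lemma edge_span_subgroup S : subgroup (edge_span S).
Proof. exact: generated_subgroup. Qed.

Lemma saturation_subgroup S : subgroup (saturation S).
Proof.
split=> [r|y z y0 z0 r]; first by rewrite raddf0.
by rewrite raddfB /= y0 z0 subrr.
Qed.

Lemma edge_span_saturation S : (edge_span S `<=` saturation S)%classic.
Proof.
apply: generated_min; first exact: saturation_subgroup.
move=> _ [e /= Se <-] r; rewrite edge_vectorE raddfMn raddfB /=.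
by rewrite !component_sum_unit (rep_orientation Se) subrr mul0rn.
Qed.

Lemma edge_span_sub S T :
  S \subset T -> (edge_span S `<=` edge_span T)%classic.
Proof.
move=> /fintype.subsetP ST; apply: generated_min;
  first exact: generated_subgroup.
by move=> _ [e /= Se <-]; apply: sub_generated; exists e => //=; apply: ST.
Qed.

(** The terms in [unit_vector (rep S v)] add up, component by component, to the
    component sums of y. *)
Lemma saturation_decomposition S y : saturation S y ->
  y = \sum_v (unit_vector v - unit_vector (rep S v)) *~ y v.
Proof.
move=> y0; under eq_bigr do rewrite mulrzBl.
rewrite sumrB -lattice_decomposition.
rewrite (partition_big (rep S) predT) //= big1 ?subr0 // => r _.
rewrite (eq_bigr (fun v => unit_vector r *~ y v)) => [|v /eqP-> //].
by rewrite -mulrz_sumr -/(component_sum S r y) y0 mulr0z.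
Qed.

Section Admissible.
Variables (q : nat) (adm : admissible G q).

(** Telescope along a path: an edge e of it contributes q / label e copies of
    its edge vector, up to sign. *)
Lemma edge_span_connect S u v :
  connect (adj S) u v -> edge_span S ((unit_vector u - unit_vector v) *+ q).
Proof.
have sL := edge_span_subgroup S.
case/connectP => p; elim: p u => [|w p IHp] u /=.
  by move=> _ ->; rewrite subrr mul0rn; case: sL.
move=> /andP[/exists_inP[e Se uw] wp] v_last.
rewrite -(subrKA (unit_vector w)) mulrnDl; apply: (subgroupD sL);
  last exact: IHp wp v_last.
have Le : edge_span S (edge_vector o e *+ (q %/ label e)).
  by apply: (subgroupMn _ sL); apply: sub_generated; exists e.
rewrite edge_vectorE -mulrnA mulnC divnK // in Le.
move: uw; rewrite o_ends => /eqP/set2_eq[[o1 o2] | [o1 o2]].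
  by rewrite -o1 -o2.
by rewrite -o1 -o2 -opprB mulNrn; apply: (subgroupN sL).
Qed.

Lemma rep_span S v :
  edge_span S ((unit_vector v - unit_vector (rep S v)) *+ q).
Proof. by apply: edge_span_connect; rewrite -rep_connect rep_id. Qed.

Lemma saturation_edge_span S y : saturation S y -> edge_span S (y *+ q).
Proof.
have sL := edge_span_subgroup S.
move=> /saturation_decomposition->; rewrite -sumrMnl.
apply: (subgroup_sum _ sL) => v _.
rewrite pmulrn -mulrzA mulrC mulrzA.
by apply: (subgroupMz _ sL); apply: rep_span.
Qed.

Lemma saturation_of_multiple S y (m : nat) :
  (0 < m)%N -> edge_span S (y *+ m) -> saturation S y.
Proof.
move=> m0 /edge_span_saturation my r; have /eqP := my r.
by rewrite raddfMn mulrn_eq0 (gtn_eqF m0) => /eqP.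
Qed.

End Admissible.

Section Colorings.
Variable n : nat.
Local Notation q := n.+1.
Hypothesis adm : admissible G q.
Implicit Type c : {ffun vertex G -> 'I_q}.

Definition equalizes c e : bool :=
  (label e * c (o e).1 == label e * c (o e).2 %[mod q])%N.

Lemma pairing_unit c v : pairing c (unit_vector v) = c v.
Proof.
rewrite /pairing (bigD1 v) //= big1 => [|u uv].
  by rewrite ffunE eqxx mulr1 addr0.
by rewrite ffunE (negbTE uv) mulr0.
Qed.

HB.instance Definition _ c :=
  GRing.isZmodMorphism.Build (lattice G) int (pairing c) (pairingB c).

Lemma pairing_edge_vector c e :
  (q %| pairing c (edge_vector o e))%Z = equalizes c e.
Proof.
rewrite edge_vectorE raddfMn raddfB /= !pairing_unit -mulr_natl natz mulrBr.
by rewrite -eqz_mod_dvd !modz_nat.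
Qed.

Lemma annihilates_edge_span c S :
  annihilates c (edge_span S) <-> forall e, e \in S -> equalizes c e.
Proof.
split=> [annc e Se | okc].
  rewrite -pairing_edge_vector; apply: annc.
  by apply: sub_generated; exists e.
apply: annihilates_generated => _ [e /= Se <-].
by rewrite pairing_edge_vector; apply: okc.
Qed.

Lemma annihilates_saturation c S :
  annihilates c (saturation S) <-> forall v, c v = c (rep S v).
Proof.
split=> [annc v | constc y y0].
  apply/val_inj/eqP; rewrite -eqz_nat -!pairing_unit.
  have /annc : saturation S (unit_vector v - unit_vector (rep S v)).
    by move=> r; rewrite raddfB /= !component_sum_unit rep_id subrr.
  by rewrite raddfB /= !pairing_unit -eqz_mod_dvd !modz_nat !modn_small.
suff -> : pairing c y = 0 by apply: dvdz0.
rewrite /pairing (partition_big (rep S) predT) //= big1 // => r _.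
rewrite (eq_bigr (fun v => (c r)%:Z * y v)) => [|v /eqP<-].
  by rewrite -mulr_sumr -/(component_sum S r y) y0 mulr0.
by rewrite -constc.
Qed.

(** A coloring constant on components is determined by its restriction to the
    representatives, extended here by 0 to the other vertices. *)
Lemma card_constant_colorings S :
  #|[set c : {ffun vertex G -> 'I_q} |
      `[< annihilates c (saturation S) >]]%SET| =
  (q ^ component_count S)%N.
Proof.
pose R := [set r | rep S r == r]%SET.
pose f c : {ffun vertex G -> 'I_q} := [ffun v => if v \in R then c v else ord0].
rewrite -(card_in_imset (f := f)).
  transitivity #|pffun_on (ord0 : 'I_q) (mem R) predT|; last first.
    by rewrite card_pffun_on card_ord.
  apply: eq_card => c; apply/imsetP/pffun_onP => [[c' _ ->]|[suppc _]].
    split=> //; apply/fintype.subsetP => v; rewrite inE ffunE.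
    by case: ifP => // _; rewrite eqxx.
  exists [ffun v => c (rep S v)].
    rewrite inE; apply/asboolP/annihilates_saturation => v.
    by rewrite !ffunE rep_id.
  apply/ffunP => v; rewrite !ffunE; case: ifPn => [|vR].
    by rewrite inE => /eqP->.
  apply/eqP; apply: contraR vR => cv; apply: (fintype.subsetP suppc).
  by rewrite inE.
move=> c c'; rewrite !inE => annc annc' /ffunP eq_f.
have {}annc := proj1 (annihilates_saturation _ _) annc.
have {}annc' := proj1 (annihilates_saturation _ _) annc'.
apply/ffunP => v; rewrite annc annc'.
by have := eq_f (rep S v); rewrite !ffunE inE rep_id eqxx.
Qed.

(** The order of the torsion subgroup of Z^V / L(S), for L(S) the span of the
    edge vectors of S. *)
Definition torsion_order S := subgroup_index (saturation S) (edge_span S).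

(** This is where admissibility enters the count of colorings: y is q times a
    vector of the saturation. *)
Lemma reduce_kernel S y :
  saturation S y -> reduce n y = 0 -> edge_span S y.
Proof.
move=> y0 /reduce_eq0 qy.
pose z : lattice G := [ffun v => (y v %/ q)%Z].
have yE : y = z *+ q.
  apply/ffunP => v; rewrite ffunMnE ffunE -mulr_natr natz.
  by rewrite divzK.
rewrite yE; apply: (saturation_edge_span adm) => r; have /eqP := y0 r.
by rewrite yE raddfMn mulrn_eq0 => /eqP.
Qed.

(** Reduction modulo q embeds the cosets into a finite set. *)
Lemma finite_cosets_saturation S :
  finite_set (cosets (saturation S) (edge_span S)).
Proof.
rewrite -(eq_finite_set (@cosets_image _ _ (@reduce _ n) _ _ _ _ _ _)).
- by apply: finite_image; apply: finite_finset.
- exact: saturation_subgroup.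
- exact: edge_span_subgroup.
- exact: edge_span_saturation.
- exact: reduce_kernel.
Qed.

(** The colorings counted here annihilate the edge span; compare its reduction
    modulo q with that of the saturation, whose annihilator has order
    q ^ component_count S. *)
Lemma card_equality_colorings S :
  #|[set c : {ffun vertex G -> 'I_q} | [forall e in S, equalizes c e]]%SET| =
  (torsion_order S * q ^ component_count S)%N.
Proof.
have sL := edge_span_subgroup S; have sH := saturation_subgroup S.
set N := LHS.
have -> : N = #|[set c : {ffun vertex G -> 'I_q} |
    `[< annihilates c (edge_span S) >]]%SET|.
  apply: eq_card => c; rewrite !inE; apply/forall_inP/asboolP.
    by move=> okc; apply/annihilates_edge_span.
  by move/annihilates_edge_span.
have := card_annihilator n sL; rewrite -(card_annihilator n sH).
rewrite card_constant_colorings.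
have cosetE := cosets_image (f := @reduce _ n) sH sL
  (@edge_span_saturation S) (@reduce_kernel S).
rewrite (@card_subgroup_index _ (reduce n @` saturation S)
  (reduce n @` edge_span S)).
- rewrite (card_eq_subgroup_index (finite_cosets_saturation S) cosetE).
  rewrite mulnC mulnAC => /eqP; rewrite eqn_pmul2r => [/eqP //|].
  rewrite cardfs_gt0; apply/fset0Pn; exists 0.
  rewrite in_fset_set; last exact: finite_finset.
  by apply/mem_set; exists 0; [case: sL | rewrite raddf0].
- exact: finite_finset.
- exact: subgroup_image.
- exact: subgroup_image.
- by apply: image_subset; apply: edge_span_saturation.
Qed.

End Colorings.
End Graph.

(** * Multiplicity and rank *)

(** Sending a representative for T to its representative for S embeds the
    components of T into those of S; the first summand counts the components of
    S missed by this embedding. *)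
Lemma component_count_sub (G : labelled_graph) (S T : {set edge G}) :
  S \subset T ->
  (#|[set r | rep S r == r & rep S (rep T r) != r]%SET| + component_count T =
   component_count S)%N.
Proof.
move=> ST; pose K := [set r | rep S r == r & rep S (rep T r) == r]%SET.
have -> : component_count T = #|K|.
  rewrite /component_count -(card_in_imset (f := rep S)).
    apply: eq_card => r; apply/imsetP/idP => [[u + ->]|].
      by rewrite !inE => /eqP uT; rewrite rep_id (rep_rep_sub u ST) uT !eqxx.
    by rewrite inE => /andP[_ /eqP rK]; exists (rep T r); rewrite ?inE ?rep_id.
  move=> u v; rewrite !inE => /eqP uT /eqP vT /(rep_sub ST).
  by rewrite uT vT.
rewrite addnC /component_count -cardsUI.
rewrite (_ : K :&: _ = finset.set0)%SET ?cards0 ?addn0.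
  by apply: eq_card => r; rewrite !inE -andb_orr orbN andbT.
apply/setP => r; rewrite !inE.
by case: (_ == r) => //; case: eqP.
Qed.

Section ContractedGroup.
Variables (G : labelled_graph) (o : edge G -> vertex G * vertex G).
Hypothesis o_ends : orientation o.
Implicit Types (A : {set edge G}) (x y : lattice G).
Local Notation D := (dotted G).
Local Notation proj := (\pi_(edge_group o))%qT.

Lemma proj_eq0 y : proj y = 0 <-> edge_span o D y.
Proof.
rewrite -[0](raddf0 (\pi_(edge_group o))%qT).
split=> [/eqP|Ly].
  by rewrite -Quotient.idealrBE subr0 => /asboolP.
by apply/eqP; rewrite -Quotient.idealrBE subr0; apply/asboolP.
Qed.

Lemma span_edgesE A :
  span_edges o A = (proj @` edge_span o (A :|: D))%classic.
Proof.
have sL := edge_span_subgroup o (A :|: D).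
rewrite eqEsubset; split.
  apply: generated_min; first exact: subgroup_image.
  move=> _ [e /= Ae <-]; exists (edge_vector o e) => //.
  by apply: sub_generated; exists e => //=; rewrite inE Ae.
move=> _ [y Ly <-]; move: y Ly.
apply: (@generated_min _ _ (proj @^-1` span_edges o A)%classic).
  exact/subgroup_preimage/generated_subgroup.
move=> _ [e /= + <-]; rewrite inE /preimage /= => /orP[Ae|De].
  by apply: sub_generated; exists e.
have /proj_eq0-> : edge_span o D (edge_vector o e).
  by apply: sub_generated; exists e.
by case: (generated_subgroup [set edge_class o e | e in [set` A]]%classic).
Qed.

Section Admissible.
Variables (n : nat) (adm : admissible G n.+1).
Local Notation q := n.+1.

Lemma cosets_proj A :
  (cosets (proj @` saturation (A :|: D)) (span_edges o A) #=
   cosets (saturation (A :|: D)) (edge_span o (A :|: D)))%card.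
Proof.
rewrite span_edgesE; apply: cosets_image.
- exact: saturation_subgroup.
- exact: edge_span_subgroup.
- exact: edge_span_saturation.
move=> y _ /proj_eq0; apply: edge_span_sub.
by rewrite finset.subsetUr.
Qed.

(** The projection of the saturation is the largest subgroup containing the span
    with finite index: a subgroup with this property consists of elements some
    multiple of which lies in the span, so they lift to vectors some multiple of
    which has zero component sums. *)
Lemma multiplicityE A : multiplicity o A = torsion_order o (A :|: D).
Proof.
have sS := saturation_subgroup (A :|: D).
have sK : subgroup (span_edges o A) by apply: generated_subgroup.
have finS := finite_cosets_saturation o_ends adm (A :|: D).
suff max_eq : max_finite_index_over (span_edges o A) =
              (proj @` saturation (A :|: D))%classic.
  by rewrite /multiplicity max_eq (card_eq_subgroup_index finS (cosets_proj A)).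
have fiS : finite_index_over (span_edges o A)
    (proj @` saturation (A :|: D))%classic.
  split; first exact: subgroup_image.
    by rewrite span_edgesE; apply: image_subset; apply: edge_span_saturation.
  by rewrite (eq_finite_set (cosets_proj A)).
have maxS H : finite_index_over (span_edges o A) H ->
    (H `<=` proj @` saturation (A :|: D))%classic.
  move=> fiH x Hx; have [m m0 Kmx] := finite_index_multiple sK fiH Hx.
  exists (repr x); last by rewrite reprK.
  apply: (saturation_of_multiple o_ends m0).
  move: Kmx; rewrite span_edgesE => -[y Ly eq_y].
  rewrite -(subrK y (repr x *+ m)).
  apply: (subgroupD (edge_span_subgroup _ _)) => //.
  apply: (@edge_span_sub _ _ D); first by rewrite finset.subsetUr.
  by apply/proj_eq0; rewrite raddfB raddfMn /= reprK eq_y subrr.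
apply: xget_unique => // H [fiH maxH].
by rewrite eqEsubset; split; [apply: maxS | apply: maxH].
Qed.

(** For S the union of A and D, the classes of q (e_r - e_r'), where r' is the
    D-representative of the S-representative of r and r ranges over the
    D-representatives with r' <> r, are independent, as the component sums over
    D show; and q times any element of the span is a combination of them, whose
    coefficients are again these sums.  The number of such r is given by
    [component_count_sub]. *)
Lemma rk_component_count A :
  (rk o A + component_count (A :|: D) = component_count D)%N.
Proof.
set S := A :|: D; have DS : D \subset S by rewrite finset.subsetUr.
rewrite -(component_count_sub DS); congr (_ + _)%N.
set J := finset _.
pose t r : lattice G :=
  (unit_vector r - unit_vector (rep D (rep S r))) *+ q.
apply: (@free_rank_eq _ _ _ (mem J) (fun r => proj (t r)) q) => //.
- exact: generated_subgroup.
- move=> r _; rewrite span_edgesE; exists (t r) => //.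
  apply: (edge_span_connect o_ends adm); rewrite -rep_connect.
  by rewrite rep_rep_sub // rep_id.
- move=> a rel_a r0 Jr0.
  have sum_t r : r \in J -> component_sum D r0 (t r) = (r == r0)%:Z *+ q.
    move: Jr0; rewrite !inE => /andP[_ Sr0] /andP[/eqP Dr _].
    rewrite raddfMn raddfB /= !component_sum_unit Dr rep_id.
    case: (rep D (rep S r) =P r0) => [Dr0|_]; last by rewrite subr0.
    case/eqP: Sr0; rewrite -[RHS]Dr0; congr rep.
    by rewrite -Dr0 (rep_rep_sub _ DS) rep_id.
  have: edge_span o D (\sum_(r in J) t r *~ a r).
    apply/proj_eq0; rewrite raddf_sum -[RHS]rel_a.
    by apply: eq_bigr => r _; rewrite raddfMz.
  move=> /(edge_span_saturation o_ends)/(_ r0); rewrite raddf_sum /=.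
  rewrite (bigD1 r0) //= big1 => [|r /andP[Jr rr0]];
    rewrite raddfMz /= sum_t //.
    rewrite eqxx addr0 => /eqP.
    by rewrite -mulrzr intz mulf_eq0 mulrn_eq0 => /eqP.
  by rewrite (negbTE rr0) mul0rn mul0rz.
- move=> x; rewrite span_edgesE => -[y Ly <-].
  have t_rep v :
      proj ((unit_vector v - unit_vector (rep S v)) *+ q) = proj (t (rep D v)).
    apply/eqP; rewrite -subr_eq0 -raddfB; apply/eqP/proj_eq0.
    rewrite /t (rep_rep_sub v DS) -mulrnBl (_ : _ - _ - _ =
      unit_vector v - unit_vector (rep D v) -
      (unit_vector (rep S v) - unit_vector (rep D (rep S v)))); last first.
      rewrite !opprB addrACA [RHS]addrACA; congr (_ + _); exact: addrC.
    rewrite mulrnBl; have [_ LB] := edge_span_subgroup o D.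
    by apply: LB; apply: rep_span.
  exists (fun r => component_sum D r y).
  rewrite -raddfMn.
  rewrite {1}(saturation_decomposition (edge_span_saturation o_ends Ly)).
  rewrite -sumrMnl raddf_sum /=.
  transitivity (\sum_v proj (t (rep D v)) *~ y v).
    apply: eq_bigr => v _; rewrite -t_rep -raddfMz /=; congr proj.
    by rewrite !pmulrn -!mulrzA mulrC.
  rewrite (partition_big (rep D) predT) //= [RHS]big_mkcond /=.
  apply: eq_bigr => r _.
  rewrite (eq_bigr (fun v => proj (t r) *~ y v)) => [|v /eqP-> //].
  rewrite -mulrz_sumr; case: ifPn => //; rewrite inE.
  case: (eqVneq (rep D r) r) => [_ /negbNE/eqP Sr | Dr _].
    by rewrite /t Sr subrr mul0rn raddf0 mul0rz.
  rewrite big1 ?mulr0z // => v /eqP Dv.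
  by case/eqP: Dr; rewrite -Dv rep_id.
Qed.

Lemma rk_le_card A : (rk o A <= #|A|)%N.
Proof.
apply: free_rank_le => s.
apply: (@free_subgroup_rank_le _ _ _ _ (edge_class o) 1%N) => //.
by move=> x /generated_comb[a ->]; exists a; rewrite mulr1n.
Qed.

End Admissible.
End ContractedGroup.

(** * Counting colorings *)

Lemma prod_nat_of_bool (I : finType) (A : {set I}) (P : pred I) :
  \prod_(i in A) (P i)%:Z = [forall i in A, P i]%:Z.
Proof.
case: (boolP [forall i in A, P i]) => [/forall_inP PA | ].
  by rewrite big1 // => i /PA->.
rewrite negb_forall_in => /exists_inP[i Ai /negbTE Pi].
by rewrite (bigD1 i) //= Pi mul0r.
Qed.

Lemma arithmetic_coloringE (G : labelled_graph)
    (o : edge G -> vertex G * vertex G) n (c : {ffun vertex G -> 'I_n.+1}) :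
  orientation o ->
  arithmetic_coloring c = [forall e, (e \in dotted G) == equalizes o c e].
Proof.
move=> o_ends; apply/forallP/forallP => okc e.
  have /forallP/(_ (o e).1)/forallP/(_ (o e).2) := okc e.
  rewrite o_ends eqxx /= /equalizes; by case: (e \in _) => // /negbTE->.
apply/forallP => u; apply/forallP => v; apply/implyP; rewrite o_ends => /eqP.
have /eqP := okc e; rewrite /equalizes => De /set2_eq[[<- <-] | [<- <-]].
  by rewrite De; case: ifP => // ->.
by rewrite De [_ == _ %[mod _]]eq_sym; case: ifP => // ->.
Qed.

(** The indicator of a proper coloring is the product over all edges of
    F c e + H c e, with F c e = 0 for dotted e and F c e = - (equalizes c e)
    for regular e.  Once this product is expanded, the set A collects the edges
    where F is chosen; terms where A contains a dotted edge vanish. *)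
Lemma chi_inclusion_exclusion (G : labelled_graph)
    (o : edge G -> vertex G * vertex G) n : orientation o ->
  (chi G n.+1)%:Z = \sum_(A : {set edge G} | A \subset regular G)
    (-1) ^+ #|A| * #|[set c : {ffun vertex G -> 'I_n.+1} |
                       [forall e in A :|: dotted G, equalizes o c e]]%SET|%:Z.
Proof.
move=> o_ends; pose D := dotted G.
pose ok (c : {ffun vertex G -> 'I_n.+1}) e := equalizes o c e.
pose F c e : int := if e \in D then 0 else - (ok c e)%:Z.
pose H c e : int := if e \in D then (ok c e)%:Z else 1.
have cardZ (P : pred {ffun vertex G -> 'I_n.+1}) :
    #|[set c | P c]%SET|%:Z = \sum_c (P c)%:Z.
  by rewrite cardsE -sum1_card big_mkcond (big_morph Posz PoszD (erefl _)).
transitivity (\sum_c \prod_e (F c e + H c e)).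
  rewrite /chi cardZ; apply: eq_bigr => c _.
  rewrite (arithmetic_coloringE _ o_ends).
  transitivity (\prod_(e in [set: edge G]%SET) ((e \in D) == ok c e)%:Z).
    rewrite prod_nat_of_bool; congr (nat_of_bool _)%:Z.
    by apply: eq_forallb => e; rewrite inE.
  apply: eq_big => [e|e _]; first by rewrite inE.
  by rewrite /F /H; case: (e \in D); case: (ok c e).
under eq_bigr do rewrite bigA_distr.
rewrite exchange_big /=.
rewrite [LHS](bigID (fun A : {set edge G} => A \subset regular G)) /=.
rewrite [X in _ + X]big1 ?addr0 => [|A]; last first.
  case/fintype.subsetPn => e Ae; rewrite inE negbK => De.
  by rewrite big1 // => c _; rewrite (bigD1 e) //= Ae /F De mul0r.
apply: eq_bigr => A AR; rewrite cardZ mulr_sumr; apply: eq_bigr => c _.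
rewrite -prod_nat_of_bool -[(-1) ^+ _]prodr_const.
rewrite [X in _ = X * _]big_mkcond [X in _ = _ * X]big_mkcond -big_split.
apply: eq_bigr => e _; rewrite inE /= /F /H.
have [Ae | _] := boolP (e \in A); last by rewrite mul1r.
by have := fintype.subsetP AR e Ae; rewrite inE => /negbTE->; rewrite mulN1r.
Qed.

Theorem theorem3p1 (G : labelled_graph)
    (o : edge G -> vertex G * vertex G) (q : nat) :
  orientation o -> (0 < q)%N -> admissible G q ->
  (chi G q)%:Z =
    (-1) ^+ (#|contracted_vertices G| - components G)
      * q%:Z ^+ components G * (arithmetic_tutte o).[1 - q%:Z, 0].
Proof.
case: q => [|n] // o_ends _ adm; set q := n.+1.
rewrite (chi_inclusion_exclusion n o_ends) card_blocks.
have -> : components G = component_count [set: edge G]%SET.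
  exact: component_countE.
have RD : (regular G :|: dotted G = [set: edge G])%SET.
  by rewrite finset.setUC finset.setUCr.
rewrite /arithmetic_tutte !horner_sum mulr_sumr; apply: eq_bigr => A AR.
rewrite (card_equality_colorings o_ends adm) (multiplicityE o_ends adm).
have kA := rk_component_count o_ends adm A.
have kR := rk_component_count o_ends adm (regular G).
have rA := rk_le_card o A; rewrite RD in kR.
have horner_nat m : (m%:R : {poly {poly int}}).[1 - q%:Z, 0] = m%:Z.
  by rewrite -polyC_natr hornerC -polyC_natr hornerC natz.
have kS := component_count_sub (finset.subsetT (A :|: dotted G)).
set d := #|_| in kS.
have -> : component_count (dotted G) =
    (rk o A + d + component_count [set: edge G]%SET)%N by rewrite -kA -kS addnA.
have -> : rk o (regular G) = (rk o A + d)%N.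
  apply: (@addIn (component_count [set: edge G]%SET)).
  by rewrite kR -kA -kS addnA.
rewrite -kS -[in LHS](subnKC rA) addnK addKn !hornerE horner_nat.
(* The two factors (-1) ^+ d cancel. *)
have sign_cancel (s x y t u w : int) : s * s = 1 ->
  x * y * (t * (u * w)) = x * s * w * t * (s * u) * y.
  by move=> ss; rewrite -[LHS]mul1r -ss; ring.
rewrite addrAC subrr sub0r [(- _) ^+ d]exprNn PoszM -!natz !natrX !exprD /=.
by apply: sign_cancel; rewrite -expr2 sqrr_sign.
Qed.
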